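(* For $0<\rho\le1$ and $0<\varphi\le\frac\pi2$ let $$A(\rho,\varphi)=\begin{pmatrix}\cos\varphi&-\rho^{-1}\sin\varphi\\ \rho\sin\varphi&\cos\varphi\end{pmatrix}.$$ Then its first angular value $\hat\theta_1(A(\rho,\varphi))$ is given by $$\hat\theta_1(A(\rho,\varphi))=\begin{cases}\varphi,&\mathrm{skew}(A(\rho,\varphi))\le1,\quad\text{(i)}\\[1mm] \varphi+\frac1\pi\int_{\{\delta<0\}}\delta(\theta)\,d\theta,&\mathrm{skew}(A(\rho,\varphi))>1,\ \frac\varphi\pi\notin\mathbb Q,\quad\text{(ii)}\\[1mm] \varphi,&\mathrm{skew}(A(\rho,\varphi))>1,\ \frac\varphi\pi=\frac1q,\ q\in\mathbb N,\ q\ge2,\quad\text{(iii)}\\[1mm] \frac1q\max_{0\le\theta\le\frac\pi2}\sum_{j=1}^qg_j(\theta),&\mathrm{skew}(A(\rho,\varphi))>1,\ \frac\varphi\pi=\frac pq,\ p,q\in\mathbb N,\ q\notin p\mathbb N.\quad\text{(iv)}\end{cases}$$ Here the functions $\delta,g_j:[0,\pi]\to\mathbb R$, $j\in\mathbb N$, are defined by $$\delta(\theta)=2\Psi_\rho(\theta)-2\Psi_\rho(\theta+\varphi)+\pi,$$ $$g_j(\theta)=\min(\theta_j-\theta_{j-1},\ \theta_{j-1}+\pi-\theta_j),\qquad \theta_{j-1}=\Psi_\rho\big((j-1)\varphi+\Psi_{\rho^{-1}}(\theta)\big),\quad j\in\mathbb N.$$ If $\frac\pi2<\varphi<\pi$,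 then $\hat\theta_1(A(\rho,\varphi))=\hat\theta_1(A(\rho,\pi-\varphi))$.
   Context: For $\lambda>0$ the function $\Psi_\lambda:\mathbb R\to\mathbb R$ is defined by $\Psi_\lambda(\theta)=\arctan(\lambda\tan\theta)$ for $|\theta|<\frac\pi2$, $\Psi_\lambda(\theta)=\theta$ for $|\theta|=\frac\pi2$, and extended by $\Psi_\lambda(\theta+n\pi)=\Psi_\lambda(\theta)+n\pi$ for $n\in\mathbb Z$. The skewness of $A\in\mathrm{GL}(\mathbb R^2)$ is $\mathrm{skew}(A)=\frac1{2r(A)}\|A-A^\top\|$ with $\|\cdot\|$ the spectral norm and $r(A)$ the spectral radius; thus $\mathrm{skew}(A(\rho,\varphi))=\frac12(\rho+\rho^{-1})|\sin\varphi|$. For nonzero $v,w\in\mathbb R^2$, $\measuredangle(v,w)=\arccos\frac{|v^\top w|}{\|v\|\|w\|}\in[0,\frac\pi2]$ is the angle between the lines spanned by $v$ and $w$. The first (upper outer) angular value of $A\in\mathrm{GL}(\mathbb R^2)$ is $\hat\theta_1(A)=\sup_{v\in\mathbb R^2,\,v\ne0}\limsup_{n\to\infty}\frac1n\sum_{j=1}^n\measuredangle(A^{j-1}v,A^jv)$. $\mathbb N=\{1,2,\dots\}$. *)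

(* Defs.v *)
From HB Require Import structures.
From mathcomp Require Import all_boot all_order all_algebra archimedean.
From mathcomp Require Import complex ring lra.
From mathcomp Require Import all_classical all_reals all_analysis.

Set Implicit Arguments.
Unset Strict Implicit.
Unset Printing Implicit Defensive.

Import Order.TTheory GRing.Theory Num.Theory.
Import numFieldNormedType.Exports.

Local Open Scope classical_set_scope.
Local Open Scope ring_scope.

Section Definitions.
Context {R : realType}.

(* The canonical norm `|v| of a matrix type is the sup norm, hence a separate
   Euclidean norm. *)
Definition enorm (v : 'cV[R]_2) : R := Num.sqrt (\sum_i v i 0 ^+ 2).

Definition spectral_norm (A : 'M[R]_2) : R :=
  sup [set enorm (A *m v) | v in [set v : 'cV[R]_2 | enorm v = 1]].

(* The complex eigenvalues of A form a finite nonempty set, so that this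
   supremum is a maximum. *)
Definition spectral_radius (A : 'M[R]_2) : R :=
  sup [set ComplexField.Normc.normc z | z in
         [set z : R[i] | eigenvalue (map_mx (real_complex R) A) z]].

Definition skewness (A : 'M[R]_2) : R :=
  (2 * spectral_radius A)^-1 * spectral_norm (A - A^T).

Definition angle (v w : 'cV[R]_2) : R :=
  acos (`|(v^T *m w) 0 0| / (enorm v * enorm w)).

(* For invertible A all the angles lie in [0, pi/2], so that the real-valued
   limn_sup and sup are the usual ones; the junk value of the average at n = 0
   does not affect the limit superior. *)
Definition first_angular_value (A : 'M[R]_2) : R :=
  sup [set limn_sup (fun n : nat =>
             n%:R^-1 * \sum_(1 <= j < n.+1)
                         angle (A ^+ j.-1 *m v) (A ^+ j *m v))
      | v in [set v : 'cV[R]_2 | v != 0]].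

Definition Amat (rho phi : R) : 'M[R]_2 :=
  \matrix_(i < 2, j < 2)
    if i == 0 then (if j == 0 then cos phi else - (rho^-1 * sin phi))
    else (if j == 0 then rho * sin phi else cos phi).

(* Psi on the fundamental domain ]-pi/2, pi/2]. *)
Definition Psi0 (lambda t : R) : R :=
  if `|t| < pi / 2 then atan (lambda * tan t) else t.

(* The integer n such that t - n pi lies in ]-pi/2, pi/2]. *)
Definition branch (t : R) : int := Num.ceil (t / pi - 2^-1).

(* Psi_in, Psi_pihalf and Psi_period below characterize Psi. *)
Definition Psi (lambda t : R) : R :=
  Psi0 lambda (t - (branch t)%:~R * pi) + (branch t)%:~R * pi.

Definition delta (rho phi t : R) : R :=
  2 * Psi rho t - 2 * Psi rho (t + phi) + pi.

Definition theta_seq (rho phi t : R) (j : nat) : R :=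
  Psi rho (j%:R * phi + Psi rho^-1 t).

Definition g (rho phi : R) (j : nat) (t : R) : R :=
  Num.min (theta_seq rho phi t j - theta_seq rho phi t j.-1)
          (theta_seq rho phi t j.-1 + pi - theta_seq rho phi t j).

Definition is_maximum (S : set R) (m : R) : Prop := S m /\ ubound S m.

Lemma branchD (t : R) (n : int) : branch (t + n%:~R * pi) = branch t + n.
Proof.
rewrite /branch mulrDl mulfK ?gt_eqF ?pi_gt0// addrAC ceilDrz ?intr_int//.
by rewrite intrKceil.
Qed.

Lemma Psi_period (lambda t : R) (n : int) :
  Psi lambda (t + n%:~R * pi) = Psi lambda t + n%:~R * pi.
Proof.
rewrite /Psi branchD intrD mulrDl addrA; congr (Psi0 _ _ + _ + _).
by rewrite opprD addrACA subrr addr0.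
Qed.

Lemma Psi_in (lambda t : R) : `|t| < pi / 2 ->
  Psi lambda t = atan (lambda * tan t).
Proof.
move=> ht; have -> : Psi lambda t = Psi0 lambda t; last by rewrite /Psi0 ht.
have p0 := pi_gt0 R.
suff b0 : branch t = 0 by rewrite /Psi b0 mul0r subr0 addr0.
apply/eqP; rewrite /branch ceil_eq; move: ht; rewrite ltr_norml => /andP[h1 h2].
rewrite ltrBDr lerBDr ltr_pdivlMr// ler_pdivrMr// !(add0r, sub0r, intrN, mulrz_nat).
rewrite (mulrC 2^-1) (ltW h2) andbT; apply: le_lt_trans h1.
by rewrite [leLHS](_ : _ = - (pi / 2)) //; field.
Qed.

Lemma Psi_pihalf (lambda t : R) : `|t| = pi / 2 -> Psi lambda t = t.
Proof.
have p0 := pi_gt0 R.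
have h0 : Psi lambda (pi / 2) = pi / 2.
  have b0 : branch (pi / 2 : R) = 0.
    by rewrite /branch mulrAC divff ?gt_eqF// mul1r subrr ceil0.
  rewrite /Psi b0 mul0r subr0 addr0 /Psi0 gtr0_norm ?ltxx//.
  by rewrite divr_gt0.
case: (ger0P t) => _ ht; first by rewrite ht.
have -> : t = pi / 2 + (-1)%:~R * pi by rewrite -[t]opprK ht intrN; field.
by rewrite Psi_period h0.
Qed.

End Definitions.

(* Main.v *)
Require Import Defs.
From mathcomp Require Import all_boot all_order all_algebra archimedean.
From mathcomp Require Import complex ring lra.
From mathcomp Require Import all_classical all_reals all_analysis.

Import Order.TTheory GRing.Theory Num.Theory.
Import numFieldNormedType.Exports.

Local Open Scope classical_set_scope.
Local Open Scope ring_scope.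

(** Write D = diag(1, rho), R(phi) for the rotation by phi and
    u(x) = (cos x, sin x).  Then A(rho, phi) = D R(phi) D^-1, so that A maps
    D u(x) to D u(x + phi).  The vector D u(x) points in the direction
    Psi_rho(x) ([Psi_polar]), and Psi_rho is nondecreasing with
    Psi_rho(x + pi) = Psi_rho(x) + pi.  With
    adv(x) = Psi_rho(x + phi) - Psi_rho(x), which lies in [0, pi], the angle
    between the lines through D u(x) and A D u(x) is
    turn(x) = min(adv(x), pi - adv(x)), and in polar coordinates the angular
    value becomes the supremum over x of the upper limits of the averages of
    turn along the orbit x, x + phi, x + 2 phi, ... ([first_angular_valueE]).
    Everything rests on three facts about such averages.

    - The averages of adv telescope and tend to phi ([cvg_avg_adv]).  Since
      turn <= adv, the value phi is an upper bound.  It is attained at every x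
      when adv <= pi/2 everywhere, which is what skew <= 1 means.

    - If q phi is a multiple of pi, the orbit is q-periodic modulo pi and the
      average tends to S(x)/q, where S(x) is the sum of turn over one period
      ([cvg_avg_periodic]).  S is continuous and phi-periodic with
      phi <= pi/2, so it attains its global maximum in [0, pi/2]; the
      substitution x = Psi_{1/rho}(theta) turns S into the sum of the g_j.
      For phi = pi/q, the orbit started at -pi/2 has adv <= pi/2 at each of
      its q steps, whence the value phi.

    - If phi/pi is irrational, the averages of a pi-periodic Lipschitz function
      f tend to its mean ([cvg_avg_irrational]).  Some d = k phi - m pi is
      nonzero and as small as desired; since a translation by k phi changes a
      Birkhoff sum by a bounded amount only, the oscillation of the n-th sum is
      at most K + n e with e arbitrarily small ([bsum_osc]), while by the mean
      value theorem, applied to a sum of translates of a primitive of f, that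
      sum takes the value n/pi times the integral of f somewhere
      ([bsum_mean_value]).  This is applied to min(0, delta), because
      turn = adv + min(0, delta).

    The last equality holds because A(rho, pi - phi) = - J A(rho, phi) J with
    J = diag(1, -1), and J preserves angles. *)

(** * The maps Psi *)

Section PsiTheory.
Context {R : realType}.
Implicit Types l x y : R.

(** The positive quadratic form cos^2 + l sin^2 along the unit circle. *)
Definition cs2 l x : R := cos x ^+ 2 + l * sin x ^+ 2.

Lemma cs2_gt0 l x : 0 < l -> 0 < cs2 l x.
Proof.
move=> l0; rewrite /cs2 sin2cos2.
have h1 := sqr_ge0 (sin x); have h2 := sqr_ge0 (cos x).
have h3 := cos2Dsin2 x; rewrite sin2cos2 in h1.
by case: (ltP 0 (cos x ^+ 2)) => h; nra.
Qed.

(** The tangent of Psi_l(x) - x, a smooth function of x on the whole line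
    (see [PsiE]). *)
Definition shear l x : R := (l - 1) * (sin x * cos x) / cs2 l x.

Lemma cosDint x (n : int) : cos (x + n%:~R * pi) = (-1) ^+ `|n|%N * cos x.
Proof.
have nat_case y (k : nat) : cos (y + k%:R * pi) = (-1) ^+ k * cos y.
  elim: k => [|k IH]; first by rewrite mul0r addr0 expr0 mul1r.
  by rewrite -natr1 mulrDl mul1r addrA cosDpi IH exprS; ring.
case: n => n; first exact: nat_case.
rewrite NegzE intrN mulNr abszN -[in RHS](subrK (n.+1%:R * pi) x) nat_case.
by rewrite mulrA -expr2 sqrr_sign mul1r.
Qed.

Lemma sinDint x (n : int) : sin (x + n%:~R * pi) = (-1) ^+ `|n|%N * sin x.
Proof. by rewrite -!cosBpihalf addrAC cosDint. Qed.

Lemma cs2D l x (n : int) : cs2 l (x + n%:~R * pi) = cs2 l x.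
Proof. by rewrite /cs2 cosDint sinDint !exprMn sqrr_sign !mul1r. Qed.

Lemma shearD l x (n : int) : shear l (x + n%:~R * pi) = shear l x.
Proof.
rewrite /shear cs2D cosDint sinDint; congr (_ * _ / _).
by rewrite mulrACA -expr2 sqrr_sign mul1r.
Qed.

Lemma branchP x : - (pi / 2) < x - (branch x)%:~R * pi <= pi / 2.
Proof.
have p0 := pi_gt0 R.
have := ceil_itv (x / pi - 2^-1); rewrite -/(branch x).
set b := (branch x)%:~R; rewrite /= intrB -/b => /andP[h1 h2].
have -> : x = x / pi * pi by rewrite mulfVK ?gt_eqF.
set y := x / pi in h1 h2 *; apply/andP; split; nra.
Qed.

Lemma is_derive_cs2 l x :
  is_derive x 1 (cs2 l) (2 * (l - 1) * (sin x * cos x)).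
Proof. by rewrite /cs2; apply: is_derive_eq; rewrite /GRing.scale /=; ring. Qed.

Lemma is_derive_atan_shear l x : 0 < l ->
  is_derive x 1 (fun y => y + atan (shear l y))
    (l / (cos x ^+ 2 + l ^+ 2 * sin x ^+ 2)).
Proof.
move=> l0; have c0 := cs2_gt0 l x l0.
have dcs := is_derive_cs2 l x.
have n0 : cs2 l x != 0 by rewrite gt_eqF.
have dsh : is_derive x 1 (shear l)
    (((l - 1) * (cos x ^+ 2 - sin x ^+ 2) * cs2 l x -
      (l - 1) * (sin x * cos x) * (2 * (l - 1) * (sin x * cos x))) / cs2 l x ^+ 2).
  have dV := is_deriveV n0.
  rewrite /shear; apply: is_derive_eq; rewrite /GRing.scale /=.
  by field.
have dat := is_derive1_atan (shear l x).
have dc := @is_derive1_comp _ atan (shear l) x _ _ dat dsh.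
apply: is_derive_eq.
have e2 : cos x ^+ 2 = 1 - sin x ^+ 2 by rewrite cos2sin2.
rewrite /shear. move: n0 c0; rewrite /cs2 => n0 c0.
have m0 : cos x ^+ 2 + l ^+ 2 * sin x ^+ 2 != 0.
  by rewrite gt_eqF// (cs2_gt0 (l ^+ 2)) ?exprn_gt0.
have k0 : (cos x ^+ 2 + l * sin x ^+ 2) ^+ 2 + ((l - 1) * (sin x * cos x)) ^+ 2 != 0.
  by rewrite gt_eqF// ltr_pwDl ?exprn_gt0 ?sqr_ge0.
move: e2 m0 k0 n0; move: (cos x) (sin x) => c s e2 m0 k0 n0.
field: e2.
by rewrite exprMn m0 n0 k0.
Qed.

(** The subtraction formula for atan (l t) and atan t; it needs no correction by
    pi because both sides have the same derivative in t and vanish at 0. *)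
Lemma atanMl l t : 0 < l ->
  atan (l * t) = atan t + atan ((l - 1) * t / (1 + l * t ^+ 2)).
Proof.
move=> l0.
pose G (u : R) := atan (l * u) - (atan u + atan ((l - 1) * u / (1 + l * u ^+ 2))).
suff : G t = G 0.
  rewrite /G !mulr0 mul0r atan0 addr0 subr0 => /eqP.
  by rewrite subr_eq0 => /eqP.
apply: is_derive_0_is_cst => u.
have n0 : 1 + l * u ^+ 2 != 0.
  by rewrite gt_eqF// ltr_pwDl// mulr_ge0 ?sqr_ge0// ltW.
have d1 : is_derive u 1 (fun u => l * u) l.
  by apply: is_derive_eq; rewrite /GRing.scale /=; ring.
have d2 : is_derive u 1 (fun u => 1 + l * u ^+ 2) (2 * l * u).
  by apply: is_derive_eq; rewrite /GRing.scale /=; ring.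
have dV := @is_deriveV _ (fun u => 1 + l * u ^+ 2) _ _ _ n0 d2.
have d3 : is_derive u 1 (fun u => (l - 1) * u / (1 + l * u ^+ 2))
    (((l - 1) * (1 + l * u ^+ 2) - (l - 1) * u * (2 * l * u))
     / (1 + l * u ^+ 2) ^+ 2).
  by apply: is_derive_eq; rewrite /GRing.scale /=; field.
have a1 := @is_derive1_comp _ atan (fun u => l * u) _ _ _ (is_derive1_atan _) d1.
have a3 := @is_derive1_comp _ atan (fun u => (l - 1) * u / (1 + l * u ^+ 2))
  _ _ _ (is_derive1_atan _) d3.
apply: is_derive_eq.
have n1 : 1 + u ^+ 2 != 0 by rewrite gt_eqF// ltr_pwDl ?sqr_ge0.
have n2 : 1 + (l * u) ^+ 2 != 0 by rewrite gt_eqF// ltr_pwDl ?sqr_ge0.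
have n3 : (1 + l * u ^+ 2) ^+ 2 + ((l - 1) * u) ^+ 2 != 0.
  by rewrite gt_eqF// ltr_pwDl ?sqr_ge0// lt0r sqrf_eq0 n0 sqr_ge0.
by field; rewrite n0 n1 n2 n3.
Qed.

(** A closed form for Psi without case distinction, from which its derivative is
    read off. *)
Lemma PsiE l x : 0 < l -> Psi l x = x + atan (shear l x).
Proof.
move=> l0; have p0 := pi_gt0 R.
have /andP[b1 b2] := branchP x.
rewrite /Psi -[in RHS](subrK ((branch x)%:~R * pi) x) shearD addrAC.
congr (_ + _); move: (x - _) b1 b2 => {x} x b1 b2.
rewrite /Psi0; case: ifPn => hx; last first.
  have -> : x = pi / 2.
    apply/eqP; rewrite eq_le b2 /= leNgt; apply: contra hx => hx.
    by rewrite ltr_norml b1.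
  by rewrite /shear cos_pihalf !mulr0 mul0r atan0 addr0.
have c0 : 0 < cos x by apply: cos_gt0_pihalf; rewrite -ltr_norml.
rewrite atanMl// tanK ?in_itv/= -?ltr_norml//; congr (_ + atan _).
have := cs2_gt0 l x l0; rewrite /shear /cs2 /tan => n0.
by field; rewrite (gt_eqF c0) (gt_eqF n0).
Qed.

Lemma is_derive_Psi l x : 0 < l ->
  is_derive x 1 (Psi l) (l / (cos x ^+ 2 + l ^+ 2 * sin x ^+ 2)).
Proof.
move=> l0; have -> : Psi l = (fun y => y + atan (shear l y)).
  by apply/funext => y; exact: PsiE.
exact: is_derive_atan_shear.
Qed.

Lemma derive_MVT (f df : R -> R) x y :
  (forall z : R, is_derive z 1 f (df z)) -> x <= y ->
  exists c, f y - f x = df c * (y - x).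
Proof.
move=> dfz xy.
have [|c _ ->] := @MVT_segment R f df x y xy (fun z _ => dfz z); last by exists c.
apply: derivable_within_continuous => z _.
by have := dfz z => dz; exact: ex_derive.
Qed.

Lemma Psi_homo l : 0 < l -> {homo Psi l : x y / x <= y}.
Proof.
move=> l0 x y xy; rewrite -subr_ge0.
have [c ->] := derive_MVT _ _ _ _ (fun z => is_derive_Psi l z l0) xy.
rewrite mulr_ge0 ?subr_ge0// divr_ge0 ?(ltW l0)//.
by rewrite ltW// (cs2_gt0 (l ^+ 2)) ?exprn_gt0.
Qed.

Lemma Psi_lipschitz l x y : 0 < l -> l <= 1 ->
  `|Psi l y - Psi l x| <= l^-1 * `|y - x|.
Proof.
move=> l0 l1; wlog xy : x y / x <= y => [H|].
  have [/H//|/ltW/H] := leP x y; by rewrite distrC (distrC x).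
have [c ->] := derive_MVT _ _ _ _ (fun z => is_derive_Psi l z l0) xy.
rewrite normrM ler_wpM2r//.
have k0 : 0 < cos c ^+ 2 + l ^+ 2 * sin c ^+ 2.
  by rewrite (cs2_gt0 (l ^+ 2)) ?exprn_gt0.
rewrite ger0_norm ?divr_ge0 ?(ltW l0) ?(ltW k0)//.
rewrite ler_pdivrMr// -(ler_pM2l l0) mulrA divff ?gt_eqF// mul1r sin2cos2.
(* cos^2 + l^2 sin^2 >= l^2, since l <= 1 *)
suff : 0 <= cos c ^+ 2 * (1 - l ^+ 2) by lra.
by rewrite mulr_ge0 ?sqr_ge0// subr_ge0 expr_le1// ltW.
Qed.

Lemma Psi_Dpi l x : Psi l (x + pi) = Psi l x + pi.
Proof. by have := Psi_period l x 1; rewrite mul1r. Qed.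

Lemma Psi_dist l x : 0 < l -> `|Psi l x - x| <= pi / 2.
Proof.
move=> l0; rewrite PsiE// addrAC subrr add0r ler_norml.
by rewrite (ltW (atan_gtNpi2 _)) (ltW (atan_ltpi2 _)).
Qed.

Lemma Psi_pi2 l : Psi l (pi / 2) = pi / 2.
Proof. by rewrite Psi_pihalf// gtr0_norm// divr_gt0// pi_gt0. Qed.

Lemma Psi0E l : Psi l 0 = 0.
Proof.
by rewrite Psi_in ?tan0 ?mulr0 ?atan0// normr0 divr_gt0// pi_gt0.
Qed.

Lemma Psi_invK l x : 0 < l -> 0 <= x <= pi / 2 -> Psi l^-1 (Psi l x) = x.
Proof.
move=> l0 /andP[x0]; rewrite le_eqVlt => /predU1P[->|x1]; first by rewrite !Psi_pi2.
have hx : `|x| < pi / 2 by rewrite ger0_norm.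
rewrite (Psi_in l hx) Psi_in; last by rewrite ltr_norml atan_gtNpi2 atan_ltpi2.
rewrite atanK mulKf ?gt_eqF// tanK// in_itv/=; move: hx; by rewrite ltr_norml.
Qed.

(** The vector (cos x, l sin x) is a positive multiple of
    (cos (Psi l x), sin (Psi l x)). *)
Lemma Psi_polar l x : 0 < l -> exists2 k, 0 < k &
  cos x = k * cos (Psi l x) /\ l * sin x = k * sin (Psi l x).
Proof.
move=> l0; rewrite PsiE//.
set w := shear l x; have c0 := cs2_gt0 l x l0.
have ca0 : 0 < cos (atan w).
  by rewrite cos_atan invr_gt0 sqrtr_gt0 ltr_pwDl ?sqr_ge0.
have sw : sin (atan w) = w * cos (atan w).
  by rewrite -{2}[w]atanK /tan mulfVK ?gt_eqF.
exists (cs2 l x / cos (atan w)); first by rewrite divr_gt0.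
have wE : w * cs2 l x = (l - 1) * (sin x * cos x) by rewrite mulfVK ?gt_eqF.
have ka (a b : R) : cs2 l x / cos (atan w) * (a * cos (atan w) + b * (w * cos (atan w)))
    = a * cs2 l x + b * ((l - 1) * (sin x * cos x)).
  by rewrite -wE; field; rewrite gt_eqF.
have e2 := cos2Dsin2 x; rewrite cosD sinD sw -mulNr !ka /cs2; split.
  by rewrite -[LHS]mulr1 -[X in _ * X = _]e2; ring.
by rewrite -[LHS]mulr1 -[X in _ * X = _]e2; ring.
Qed.

End PsiTheory.

(** * Reduction of the angular value to averages along a rotation *)

Section AngularValue.
Context {R : realType}.
Implicit Types rho phi x y : R.

(** The increase of the lifted direction Psi_rho in one step of the rotation. *)
Definition adv rho phi x : R := Psi rho (x + phi) - Psi rho x.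

(** The angle between the lines in the directions Psi_rho(x) and
    Psi_rho(x + phi), for 0 <= phi <= pi. *)
Definition turn rho phi x : R := Num.min (adv rho phi x) (pi - adv rho phi x).

(** The Birkhoff sum f(x) + f(x + phi) + ... of the first n terms along the
    rotation by phi, without reduction modulo pi. *)
Definition bsum (f : R -> R) phi x (n : nat) : R :=
  \sum_(0 <= j < n) f (x + j%:R * phi).

(** The Birkhoff average; its value at n = 0 is 0. *)
Definition avg (f : R -> R) phi x (n : nat) : R := n%:R^-1 * bsum f phi x n.

(** The column vector (a, b). *)
Definition vec2 (a b : R) : 'cV[R]_2 := \col_i (if i == 0 then a else b).

Lemma vec2E (v : 'cV[R]_2) : v = vec2 (v 0 0) (v 1 0).
Proof.
apply/matrixP => i j; rewrite !mxE (ord1 j).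
by case: i => -[|[|//]] hi; congr (v _ _); exact/val_inj.
Qed.

Lemma enorm_vec2 a b : enorm (vec2 a b) = Num.sqrt (a ^+ 2 + b ^+ 2).
Proof. by rewrite /enorm !big_ord_recl big_ord0 !mxE /= addr0. Qed.

Lemma dot_vec2 a b c d : ((vec2 a b)^T *m vec2 c d) 0 0 = a * c + b * d.
Proof. by rewrite !mxE !big_ord_recl big_ord0 !mxE /= addr0. Qed.

Lemma Amat_vec2 rho phi a b : Amat rho phi *m vec2 a b =
  vec2 (cos phi * a - rho^-1 * sin phi * b) (rho * sin phi * a + cos phi * b).
Proof.
apply/matrixP => i j; rewrite !mxE !big_ord_recl big_ord0 !mxE /= addr0.
by case: i => -[|[|//]] hi /=; rewrite ?mulNr.
Qed.

Lemma polar_coord (a b : R) : (a, b) != (0, 0) ->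
  exists r x, [/\ 0 < r, a = r * cos x & b = r * sin x].
Proof.
move=> ab0.
have s0 : 0 < a ^+ 2 + b ^+ 2.
  rewrite lt0r addr_ge0 ?sqr_ge0// andbT paddr_eq0 ?sqr_ge0// !sqrf_eq0.
  by move: ab0; rewrite xpair_eqE.
pose r := Num.sqrt (a ^+ 2 + b ^+ 2).
have r0 : 0 < r by rewrite sqrtr_gt0.
have r2 : r ^+ 2 = a ^+ 2 + b ^+ 2 by rewrite sqr_sqrtr// ltW.
have car : -1 <= a / r <= 1.
  rewrite -ler_norml normf_div (gtr0_norm r0) ler_pdivrMr// mul1r.
  by rewrite -(@ler_pXn2r _ 2) ?nnegrE// ?(ltW r0)//
    real_normK ?num_real// r2 lerDl sqr_ge0.
have sb : Num.sqrt (1 - (a / r) ^+ 2) = `|b| / r.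
  have -> : 1 - (a / r) ^+ 2 = (b / r) ^+ 2.
    by rewrite !expr_div_n r2; field; rewrite gt_eqF.
  by rewrite sqrtr_sqr normf_div (gtr0_norm r0).
case: (leP 0 b) => hb.
  exists r, (acos (a / r)); split => //.
    by rewrite acosK ?in_itv//= mulrC mulfVK ?gt_eqF.
  by rewrite sin_acos// sb ger0_norm// mulrC mulfVK ?gt_eqF.
exists r, (- acos (a / r)); split => //.
  by rewrite cosN acosK ?in_itv//= mulrC mulfVK ?gt_eqF.
by rewrite sinN sin_acos// sb ltr0_norm// mulNr opprK mulrC mulfVK ?gt_eqF.
Qed.

Lemma acos_normr_cos (d : R) : 0 <= d <= pi ->
  acos `|cos d| = Num.min d (pi - d).
Proof.
move=> /andP[d0 d1]; have p0 := pi_gt0 R.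
case: (leP d (pi / 2)) => h.
  rewrite ger0_norm ?cosK ?in_itv/= ?d0//; last first.
    by rewrite cos_ge0_pihalf// h andbT; lra.
  by apply/esym/min_idPl; lra.
have -> : `|cos d| = cos (pi - d).
  have e : cos (pi - d) = - cos d by rewrite cosB cospi sinpi mul0r addr0 mulN1r.
  by rewrite -normrN -e ger0_norm// cos_ge0_pihalf//; lra.
rewrite cosK ?in_itv/=; last lra.
by apply/esym/min_idPr; lra.
Qed.

Lemma angle_vec2 r s (a b : R) : 0 < r -> 0 < s -> a <= b <= a + pi ->
  angle (vec2 (r * cos a) (r * sin a)) (vec2 (s * cos b) (s * sin b)) =
  Num.min (b - a) (pi - (b - a)).
Proof.
move=> r0 s0 ab; have en k c : 0 < k -> enorm (vec2 (k * cos c) (k * sin c)) = k.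
  move=> k0; rewrite enorm_vec2 !exprMn -mulrDr cos2Dsin2 mulr1 sqrtr_sqr.
  by rewrite gtr0_norm.
rewrite /angle dot_vec2 !en// -acos_normr_cos; last lra.
have -> : r * cos a * (s * cos b) + r * sin a * (s * sin b) = r * s * cos (b - a).
  by rewrite cosB; ring.
rewrite normrM gtr0_norm ?mulr_gt0// mulrC mulKf// gt_eqF//.
by rewrite mulr_gt0.
Qed.

Lemma adv_itv rho phi x : 0 < rho -> 0 <= phi <= pi -> 0 <= adv rho phi x <= pi.
Proof.
move=> r0 /andP[p0 p1]; rewrite /adv subr_ge0 Psi_homo ?lerDl//= lerBlDl.
by rewrite -Psi_Dpi Psi_homo// lerD2l.
Qed.

Lemma angle_Amat rho phi r x : 0 < rho -> 0 <= phi <= pi -> 0 < r ->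
  angle (vec2 (r * cos x) (r * (rho * sin x)))
        (vec2 (r * cos (x + phi)) (r * (rho * sin (x + phi)))) = turn rho phi x.
Proof.
move=> rho0 hphi r0.
have [k k0 [-> ->]] := Psi_polar rho x rho0.
have [k' k'0 [-> ->]] := Psi_polar rho (x + phi) rho0.
rewrite !mulrA angle_vec2 ?mulr_gt0//.
by have := adv_itv rho phi x rho0 hphi; rewrite /adv; lra.
Qed.

Lemma Amat_iter rho phi r x (n : nat) : 0 < rho ->
  Amat rho phi ^+ n *m vec2 (r * cos x) (r * (rho * sin x)) =
  vec2 (r * cos (x + n%:R * phi)) (r * (rho * sin (x + n%:R * phi))).
Proof.
move=> rho0; elim: n => [|n IH]; first by rewrite expr0 mul1mx mul0r addr0.
rewrite exprS -[_ * _]/(_ *m _) -mulmxA IH Amat_vec2 -natr1 mulrDl mul1r addrA.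
set y := x + n%:R * phi; rewrite (cosD y) (sinD y).
congr vec2; first by field; rewrite gt_eqF.
by ring.
Qed.

(** Every nonzero vector is r (cos x, rho sin x) for some r > 0 and x, and the
    angles along its orbit under A are the values of [turn] along the orbit of x. *)
Lemma first_angular_valueE rho phi : 0 < rho -> 0 <= phi <= pi ->
  first_angular_value (Amat rho phi) =
  sup [set limn_sup (avg (turn rho phi) phi x) | x in [set: R]].
Proof.
move=> rho0 hphi; rewrite /first_angular_value; apply: (congr1 (@sup R)).
have key r x : 0 < r ->
    (fun n : nat => n%:R^-1 * \sum_(1 <= j < n.+1)
       angle (Amat rho phi ^+ j.-1 *m vec2 (r * cos x) (r * (rho * sin x)))
             (Amat rho phi ^+ j *m vec2 (r * cos x) (r * (rho * sin x)))) =
    avg (turn rho phi) phi x.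
  move=> r0; apply/funext => n; rewrite /avg /bsum; congr (_ * _).
  rewrite big_add1 /=; apply: eq_bigr => j _.
  rewrite !Amat_iter// -(angle_Amat rho phi r)//; congr angle.
  by rewrite -natr1 mulrDl mul1r addrA.
apply/seteqP; split => y /=.
- case=> v v0 <-.
  have : (v 0 0, v 1 0 / rho) != (0, 0).
    apply: contra v0 => /eqP[h1 /eqP]; rewrite mulf_eq0 invr_eq0 (gt_eqF rho0) orbF.
    move=> /eqP h2; rewrite [v]vec2E h1 h2; apply/eqP/matrixP => i j.
    by rewrite !mxE if_same.
  move=> /polar_coord[r [x [r0 h1 h2]]]; exists x => //.
  have h3 : v 1 0 = r * (rho * sin x).
    by rewrite mulrCA -h2 mulrC mulfVK ?gt_eqF.
  by rewrite [v]vec2E h1 h3 key.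
- case=> x _ <-; exists (vec2 (1 * cos x) (1 * (rho * sin x))); last by rewrite key.
  rewrite !mul1r; apply/eqP => /matrixP h.
  have := h 0 0; have := h 1 0; rewrite !mxE /= => /eqP.
  rewrite mulf_eq0 (gt_eqF rho0) /= => /eqP s0 c0.
  by have := cos2Dsin2 x; rewrite s0 c0 expr0n addr0 => /eqP; rewrite eq_sym oner_eq0.
Qed.

End AngularValue.

(** * Birkhoff sums and averages along a rotation *)

Section BirkhoffAverages.
Context {R : realType}.
Implicit Types (f : R -> R) (phi x y : R).

(** The cocycle identity. *)
Lemma bsumD f phi x (m n : nat) :
  bsum f phi x (m + n) = bsum f phi x m + bsum f phi (x + m%:R * phi) n.
Proof.
rewrite /bsum (@big_cat_nat _ _ _ m) ?leq_addr//=; congr (_ + _).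
rewrite -{1}[m]add0n big_addn addKn; apply: eq_bigr => j _.
by rewrite addnC natrD mulrDl addrA.
Qed.

Lemma bsumS f phi x (n : nat) :
  bsum f phi x n.+1 = bsum f phi x n + f (x + n%:R * phi).
Proof. by rewrite /bsum big_nat_recr. Qed.

Lemma bsum0 f phi x : bsum f phi x 0 = 0.
Proof. by rewrite /bsum big_geq. Qed.

Lemma bsum_norm f phi x C (n : nat) :
  (forall y, `|f y| <= C) -> `|bsum f phi x n| <= n%:R * C.
Proof.
move=> fC; elim: n => [|n IH]; first by rewrite bsum0 normr0 mul0r.
rewrite bsumS -natr1 mulrDl mul1r (le_trans (ler_normD _ _))//.
by rewrite lerD.
Qed.

Lemma bsum_lip f phi x y L (n : nat) :
  (forall u v, `|f v - f u| <= L * `|v - u|) ->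
  `|bsum f phi y n - bsum f phi x n| <= n%:R * (L * `|y - x|).
Proof.
move=> fL; elim: n => [|n IH]; first by rewrite !bsum0 subrr normr0 mul0r.
rewrite !bsumS -natr1 mulrDl mul1r opprD addrACA (le_trans (ler_normD _ _))//.
rewrite lerD// (le_trans (fL _ _))//.
by rewrite opprD addrACA subrr addr0.
Qed.

Lemma periodic_int f T x (m : int) :
  (forall y, f (y + T) = f y) -> f (x + m%:~R * T) = f x.
Proof.
move=> fT; have fn y (k : nat) : f (y + k%:R * T) = f y.
  by rewrite mulr_natl; apply: periodicn => z; exact: fT.
case: m => k; first exact: fn.
by rewrite NegzE intrN mulNr -[in RHS](subrK (k.+1%:R * T) x) fn.
Qed.

Lemma bsum_Dpi f phi x (m : int) (n : nat) :
  (forall y, f (y + pi) = f y) ->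
  bsum f phi (x + m%:~R * pi) n = bsum f phi x n.
Proof.
by move=> fpi; apply: eq_bigr => j _; rewrite addrAC periodic_int.
Qed.

Lemma cvg_bounded_over_n (B : nat -> R) C :
  (forall n, `|B n| <= C) -> n%:R^-1 * B n @[n --> \oo] --> (0 : R).
Proof.
move=> BC.
have c0 : (n%:R^-1 : R) @[n --> \oo] --> (0 : R).
  apply/gtr0_cvgV0; last exact: cvgr_idn.
  by exists 1%N => // n /= n0; rewrite ltr0n.
have cC a : n%:R^-1 * a @[n --> \oo] --> (0 : R).
  by rewrite -(mul0r a); apply: cvgM => //; exact: cvg_cst.
apply: (@squeeze_cvgr _ _ _ _ (fun n => n%:R^-1 * - C) (fun n => n%:R^-1 * C)) => //.
near=> n; have := BC n; rewrite ler_norml => /andP[h1 h2].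
by rewrite !ler_wpM2l ?invr_ge0.
Unshelve. all: by end_near. Qed.

Lemma cvg_avg f phi x l C :
  (forall n, `|bsum f phi x n - n%:R * l| <= C) ->
  avg f phi x n @[n --> \oo] --> l.
Proof.
move=> /cvg_bounded_over_n h.
have : n%:R^-1 * (bsum f phi x n - n%:R * l) + l @[n --> \oo] --> 0 + l.
  by apply: cvgD => //; exact: cvg_cst.
rewrite add0r; apply: cvg_trans; apply: near_eq_cvg; exists 1%N => // n /= n0.
by rewrite /avg mulrBr mulrA mulVf ?mul1r ?subrK// pnatr_eq0 -lt0n.
Qed.

(** The deviations bsum n - n l, with l the mean over one period, are q-periodic
    in n, hence bounded. *)
Lemma cvg_avg_periodic f phi x (q : nat) : (0 < q)%N ->
  (forall y, f (y + q%:R * phi) = f y) ->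
  avg f phi x n @[n --> \oo] --> q%:R^-1 * bsum f phi x q.
Proof.
move=> q0 fq; set l := q%:R^-1 * _.
pose B n := bsum f phi x n - n%:R * l.
have per k n : B (k * q + n)%N = B n.
  elim: k => [|k IH] //; rewrite mulSn -addnA -[RHS]IH /B bsumD natrD mulrDl.
  rewrite {3}/l mulVKf ?pnatr_eq0 -?lt0n//.
  rewrite (_ : bsum f phi (x + q%:R * phi) _ = bsum f phi x (k * q + n)).
    by rewrite opprD addrACA subrr add0r.
  by apply: eq_bigr => j _; rewrite addrAC fq.
apply: (@cvg_avg _ _ _ _ (\sum_(i < q) `|B i|)) => n.
rewrite -/(B n) (divn_eq n q) per.
rewrite (bigD1 (Ordinal (ltn_pmod n q0))) //= lerDl.
by apply: sumr_ge0.
Qed.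

End BirkhoffAverages.

(** * Small return times of an irrational rotation *)

Section Equidistribution.
Context {R : realType}.
Implicit Types (f : R -> R) (phi x y C L e : R).

(** Pigeonhole principle: two of the N + 2 numbers j phi modulo pi lie in the same
    of N + 1 equal subintervals of [0, pi). *)
Lemma irrational_small_step phi e :
  (~ exists r : rat, phi / pi = ratr r) -> 0 < e ->
  exists (k : nat) (m : int), 0 < `|k%:R * phi - m%:~R * pi| < e.
Proof.
move=> irr e0; have p0 := pi_gt0 R.
pose N := (Num.truncn (pi / e)).
have Ne : pi < N.+1%:R * e.
  by have := truncnS_gt (pi / e); rewrite -/N ltr_pdivrMr.
pose m (j : nat) := Num.floor (j%:R * phi / pi).
(* r j is j phi modulo pi, and c j the index of its subinterval *)
pose r (j : nat) := j%:R * phi - (m j)%:~R * pi.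
have rP j : 0 <= r j < pi.
  have := floor_itv (j%:R * phi / pi); rewrite -/(m j) intrD => /andP[].
  by rewrite ler_pdivlMr// ltr_pdivrMr// mulrDl mul1r /r; lra.
pose c (j : 'I_N.+2) : 'I_N.+1 := inord (Num.truncn (r j / pi * N.+1%:R)).
have cP j : (c j : nat)%:R <= r j / pi * N.+1%:R < (c j : nat)%:R + 1.
  have /andP[r0 r1] := rP j.
  have q0 : 0 <= r j / pi * N.+1%:R by rewrite mulr_ge0// divr_ge0// ltW.
  rewrite natr1 inordK; first exact: truncn_itv.
  by rewrite truncn_lt_nat// gtr_pMl ?ltr0n// ltr_pdivrMr// mul1r.
have : ~~ injectiveb c.
  by apply/negP => /injectiveP/leq_card; rewrite !card_ord ltnn.
case/injectivePn => i [j ij cij].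
wlog lt_ij : i j ij cij / (i < j)%N.
  move=> H; have := ij; rewrite -val_eqE neq_ltn => /orP[|] h; first exact: (H i j).
  by apply: (H j i) => //; rewrite eq_sym.
exists (j - i)%N, (m j - m i).
have -> : (j - i)%N%:R * phi - (m j - m i)%:~R * pi = r j - r i.
  by rewrite /r natrB 1?ltnW// intrB; ring.
have := cP i; have := cP j; rewrite -cij => hj hi.
have rE k : r k = pi / N.+1%:R * (r k / pi * N.+1%:R).
  have n0 : N.+1%:R != 0 :> R by rewrite pnatr_eq0.
  by rewrite mulrACA mulVf// mulr1 mulrC mulfVK ?gt_eqF.
apply/andP; split; last first.
  rewrite (rE j) (rE i) -mulrBr normrM gtr0_norm ?divr_gt0//.
  apply: (@le_lt_trans _ _ (pi / N.+1%:R)).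
    by rewrite ler_piMr ?divr_ge0 ?(ltW p0)// ler_norml; lra.
  by rewrite ltr_pdivrMr// mulrC.
rewrite normr_gt0 subr_eq0; apply/eqP => rij; apply: irr.
exists ((m j - m i)%:~R / (j - i)%N%:R).
have k0 : (j - i)%N%:R != 0 :> R by rewrite pnatr_eq0 subn_eq0 -ltnNge.
rewrite fmorph_div /= ratr_int ratr_nat; apply/eqP.
rewrite eqr_div ?(gt_eqF p0)//; apply/eqP.
move: rij; rewrite /r. rewrite intrB natrB 1?ltnW//; lra.
Qed.

(** The oscillation of the n-th Birkhoff sum grows at most like n L e with e
    arbitrarily small: any two points are joined, modulo pi, by boundedly many
    steps of length |k phi - m pi| < e followed by a shift of length at most e. *)
Lemma bsum_osc f phi C L e :
  (forall y, f (y + pi) = f y) -> (forall y, `|f y| <= C) ->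
  (forall u v, `|f v - f u| <= L * `|v - u|) ->
  (~ exists r : rat, phi / pi = ratr r) -> 0 < e ->
  exists K, forall x y n,
    `|bsum f phi y n - bsum f phi x n| <= K + n%:R * (L * e).
Proof.
move=> fpi fC fL irr e0; have p0 := pi_gt0 R.
have C0 : 0 <= C by rewrite (le_trans _ (fC 0)).
have L0 : 0 <= L by have := fL 0 1; rewrite subr0 normr1 mulr1; apply: le_trans.
have [k [m]] := irrational_small_step _ _ irr e0.
set d := k%:R * phi - m%:~R * pi => /andP[d0 de].
(* The Birkhoff sums of length n from x and from x + k phi differ by two sums
   of k terms. *)
pose K := k%:R * C + k%:R * C.
have step1 x n : `|bsum f phi (x + d) n - bsum f phi x n| <= K.
  rewrite /d addrA -mulNr -intrN bsum_Dpi//.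
  have e1 := bsumD f phi x k n; have e2 := bsumD f phi x n k.
  have -> : bsum f phi (x + k%:R * phi) n - bsum f phi x n =
      bsum f phi (x + n%:R * phi) k - bsum f phi x k.
    by move: e1; rewrite addnC e2; lra.
  by rewrite (le_trans (ler_normB _ _))// lerD// bsum_norm.
have step x n : `|bsum f phi (x + `|d|) n - bsum f phi x n| <= K.
  case: (ger0P d) => _; first exact: step1.
  by have := step1 (x - d) n; rewrite subrK distrC.
have steps x n (i : nat) :
    `|bsum f phi (x + i%:R * `|d|) n - bsum f phi x n| <= i%:R * K.
  elim: i => [|i IH]; first by rewrite !mul0r addr0 subrr normr0.
  rewrite -natr1 !mulrDl !mul1r addrA.
  have := step (x + i%:R * `|d|) n; move: IH.
  set a := bsum _ _ _ _; set b := bsum _ _ _ _; set c := bsum _ _ _ _.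
  move=> h1 h2; rewrite (_ : c - b = (a - b) + (c - a)); last ring.
  by rewrite (le_trans (ler_normD _ _))// lerD.
exists ((Num.truncn (pi / `|d|)).+1%:R * K) => x y n.
pose m' := Num.floor ((y - x) / pi); pose z := y - x - m'%:~R * pi.
have zP : 0 <= z < pi.
  have := floor_itv ((y - x) / pi); rewrite -/m' intrD => /andP[].
  by rewrite ler_pdivlMr// ltr_pdivrMr// mulrDl mul1r /z; lra.
have -> : bsum f phi y n = bsum f phi (x + z) n.
  rewrite -[RHS](bsum_Dpi _ _ _ m')//; congr bsum.
  by rewrite /z; ring.
have /andP[z0 z1] := zP.
pose i := Num.truncn (z / `|d|).
have /truncn_itv : 0 <= z / `|d| by rewrite divr_ge0.
rewrite -/i ler_pdivlMr// ltr_pdivrMr// -natr1 mulrDl mul1r => /andP[i0 i1].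
have iN : i%:R <= (Num.truncn (pi / `|d|)).+1%:R :> R.
  by rewrite ler_nat leqW// le_truncn// ler_wpM2r ?invr_ge0// ltW.
have := steps x n i.
have := bsum_lip f phi (x + i%:R * `|d|) (x + z) L n fL.
set a := bsum _ _ _ _; set b := bsum _ _ _ _; set c := bsum _ _ _ _.
move=> h1 h2; rewrite (_ : a - c = (b - c) + (a - b)); last ring.
rewrite (le_trans (ler_normD _ _))// lerD//.
  by rewrite (le_trans h2)// ler_wpM2r// /K addr_ge0// mulr_ge0.
rewrite (le_trans h1)// !ler_wpM2l//.
by rewrite opprD addrACA subrr add0r ger0_norm; lra.
Qed.

End Equidistribution.

(** * Equidistribution of irrational rotations *)

Section MeanValue.
Context {R : realType}.
Implicit Types (f : R -> R) (phi x y C L e : R).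
Notation mu := (@lebesgue_measure R).

Lemma continuous_itv_integrable f (a b : R) : continuous f ->
  mu.-integrable `[a, b] (EFin \o f).
Proof.
move=> fc; apply: continuous_compact_integrable; first exact: segment_compact.
exact: continuous_subspaceT.
Qed.

Lemma is_derive_primitive f (a x : R) : continuous f -> a < x ->
  is_derive x 1 (fun z : R => \int[mu]_(t in `[a, z]) f t) (f x).
Proof.
move=> fc ax.
have x1 : x < x + 1 by rewrite ltrDl.
have [d1 d2] := continuous_FTC1_closed x1
  (continuous_itv_integrable f a (x + 1) fc) ax (fc x).
by apply: DeriveDef; [exact: d1|rewrite -derive1E; exact: d2].
Qed.

(** The derivative of Q(z) = sum_j P(z + j phi), with P a primitive of f, is the
    Birkhoff sum of f, and Q(pi) - Q(0) is n times the integral of f. *)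
Lemma bsum_mean_value f phi (n : nat) : continuous f ->
  (forall y, f (y + pi) = f y) -> 0 <= phi ->
  exists y, bsum f phi y n * pi = n%:R * \int[mu]_(t in `[0, pi]) f t.
Proof.
move=> fc fpi phi0; have p0 := pi_gt0 R.
(* The base point -1 makes P differentiable on a neighbourhood of [0, +oo[. *)
pose P (z : R) := \int[mu]_(t in `[-1, z]) f t.
have dP (a x : R) : -1 < x + a -> is_derive x 1 (fun z => P (z + a)) (f (x + a)).
  move=> xa; have d1 : is_derive x 1 (fun z : R => z + a) 1.
    by apply: is_derive_eq; rewrite addr0.
  have d2 := is_derive_primitive f (-1) (x + a) fc xa.
  have := @is_derive1_comp _ P (fun z => z + a) x _ _ d2 d1.
  by rewrite mulr1.
have within (F dF : R -> R) (a b : R) :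
    (forall x, a <= x -> is_derive x 1 F (dF x)) ->
    {within `[a, b], continuous F}.
  move=> h; apply: derivable_within_continuous => x; rewrite in_itv/= => /andP[ax _].
  by have := h x ax => hx; exact: ex_derive.
have Ppi (x : R) : 0 <= x -> P (x + pi) - P x = \int[mu]_(t in `[0, pi]) f t.
  move=> x0.
  have -> : \int[mu]_(t in `[0, pi]) f t = P (0 + pi) - P 0.
    rewrite add0r /P Rintegral_itvB ?bnd_simp ?(ltW p0)//.
    - rewrite Rintegral_itv_obnd_cbnd//.
      apply: integrableS (continuous_itv_integrable f 0 pi fc) => //.
      by apply: subset_itvr; rewrite bnd_simp.
    - exact: continuous_itv_integrable.
  have dW (z : R) : 0 <= z -> is_derive z 1 (fun u => P (u + pi) - P (u + 0)) 0.
    move=> z0; have d1 : is_derive z 1 (fun u => P (u + pi)) (f (z + pi)).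
      by apply: dP; lra.
    have d2 : is_derive z 1 (fun u => P (u + 0)) (f (z + 0)) by apply: dP; lra.
    by apply: is_derive_eq; rewrite fpi addr0 subrr.
  have [||c _] := @MVT_segment R (fun u => P (u + pi) - P (u + 0)) (fun=> 0) 0 x x0.
  - by move=> z; rewrite in_itv/= => /andP[/ltW z0 _]; exact: dW.
  - exact: (within _ (fun=> 0)).
  by rewrite mul0r !addr0 => /eqP; rewrite subr_eq0 => /eqP.
pose Q (z : R) := \sum_(j < n) P (z + j%:R * phi).
have dQ (z : R) : 0 <= z -> is_derive z 1 Q (bsum f phi z n).
  move=> z0; rewrite /bsum big_mkord.
  have -> : Q = \sum_(j < n) (fun z => P (z + j%:R * phi)).
    by apply/funext => u; rewrite fct_sumE.
  apply: is_derive_sum => j; apply: dP.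
  by rewrite (lt_le_trans (ltrN10 _))// addr_ge0// mulr_ge0.
have [||c _ hc] := @MVT_segment R Q (fun z => bsum f phi z n) 0 pi (ltW p0).
- by move=> z; rewrite in_itv/= => /andP[/ltW z0 _]; exact: dQ.
- exact: (within _ (fun z => bsum f phi z n)).
exists c; move: hc; rewrite subr0 => <-; rewrite /Q -sumrB.
under eq_bigr => j _ do rewrite add0r addrC [pi + _]addrC [- _ + _]addrC Ppi ?mulr_ge0//.
by rewrite sumr_const card_ord mulr_natl.
Qed.

Lemma lipschitz_continuous f L :
  (forall u v, `|f v - f u| <= L * `|v - u|) -> continuous f.
Proof.
move=> fL x; have L0 : 0 <= L.
  by have := fL 0 1; rewrite subr0 normr1 mulr1; apply: le_trans.
have L1 : 0 < L + 1 by rewrite ltr_wpDl.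
apply/cvgrPdist_le => e e0.
have : \forall y \near x, `|x - y| <= e / (L + 1).
  apply/nbhs_ballP; exists (e / (L + 1)); first by rewrite /= divr_gt0.
  by move=> y; rewrite /ball/= => /ltW.
apply: filterS => y; rewrite ler_pdivlMr// => xy.
by rewrite (le_trans (fL _ _))// (le_trans _ xy)// mulrC ler_wpM2l// lerDl.
Qed.

Lemma cvg_avg_irrational f phi C L x :
  (forall y, f (y + pi) = f y) -> (forall y, `|f y| <= C) ->
  (forall u v, `|f v - f u| <= L * `|v - u|) ->
  (~ exists r : rat, phi / pi = ratr r) -> 0 <= phi ->
  avg f phi x n @[n --> \oo] --> pi^-1 * \int[mu]_(t in `[0, pi]) f t.
Proof.
move=> fpi fC fL irr phi0; have p0 := pi_gt0 R.
have L0 : 0 <= L by have := fL 0 1; rewrite subr0 normr1 mulr1; apply: le_trans.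
set I := \int[mu]_(t in _) _.
apply/cvgrPdist_le => e e0.
(* e' is such that L e' <= e / 2. *)
pose e' := e / 2 / (L + 1).
have e'0 : 0 < e' by rewrite !divr_gt0// ltr_wpDl.
have Le : L * e' <= e / 2.
  rewrite /e' mulrA ler_pdivrMr ?ltr_wpDl// mulrC ler_wpM2l ?lerDl//.
  by rewrite divr_ge0// ltW.
have [K hK] := bsum_osc f phi C L e' fpi fC fL irr e'0.
have hKn n : `|n%:R * (pi^-1 * I) - bsum f phi x n| <= K + n%:R * (L * e').
  have [y hy] := bsum_mean_value f phi n (lipschitz_continuous f L fL) fpi phi0.
  rewrite (_ : n%:R * (pi^-1 * I) = bsum f phi y n) ?hK//.
  by rewrite mulrCA -hy mulrCA mulVf ?gt_eqF// mulr1.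
near=> n.
have n0 : 0 < n%:R :> R by rewrite ltr0n; near: n; exists 1%N.
have -> : pi^-1 * I - avg f phi x n =
    n%:R^-1 * (n%:R * (pi^-1 * I) - bsum f phi x n).
  by rewrite mulrBr mulKf ?gt_eqF.
rewrite normrM ger0_norm ?invr_ge0 ?(ltW n0)// ler_pdivrMl// (le_trans (hKn n))//.
have : K <= n%:R * (e / 2).
  rewrite -ler_pdivrMr ?divr_gt0//; near: n.
  exact: nbhs_infty_ger.
by move: Le; rewrite -(ler_pM2l n0); lra.
Unshelve. all: by end_near. Qed.

End MeanValue.

(** * Bounds on the advance, and the skewness *)

Section Rotation.
Context {R : realType}.
Implicit Types (rho phi x y : R).
Notation C := (real_complex R).

(** The angular value when all the averages converge and the limit is maximal at
    x0. *)
Lemma first_angular_value_max rho phi (c : R -> R) x0 :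
  0 < rho -> 0 <= phi <= pi ->
  (forall x, avg (turn rho phi) phi x n @[n --> \oo] --> c x) ->
  (forall x, c x <= c x0) ->
  first_angular_value (Amat rho phi) = c x0.
Proof.
move=> r0 hphi hc cx0; rewrite first_angular_valueE//.
have lc x : limn_sup (avg (turn rho phi) phi x) = c x.
  rewrite cvg_limn_supE; first exact: cvg_lim (hc x).
  by apply/cvg_ex; exists (c x); exact: hc.
have ub : ubound [set limn_sup (avg (turn rho phi) phi x) | x in [set: R]] (c x0).
  by move=> _ [x _ <-]; rewrite lc.
apply/eqP; rewrite eq_le; apply/andP; split.
  by apply: ge_sup => //; exists (c x0), x0.
by apply: ub_le_sup; [exists (c x0)|exists x0].
Qed.

Lemma turn_le_adv rho phi x : turn rho phi x <= adv rho phi x.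
Proof. by rewrite /turn ge_min lexx. Qed.

Lemma turn_adv rho phi x : adv rho phi x <= pi / 2 -> turn rho phi x = adv rho phi x.
Proof. by move=> h; apply/min_idPl; lra. Qed.

Lemma turnE rho phi x :
  turn rho phi x = adv rho phi x + Num.min 0 (delta rho phi x).
Proof.
have -> : delta rho phi x = pi - adv rho phi x - adv rho phi x.
  by rewrite /delta /adv; ring.
by rewrite /turn addr_minr addr0; congr Num.min; ring.
Qed.

Lemma bsum_adv rho phi x (n : nat) :
  bsum (adv rho phi) phi x n = Psi rho (x + n%:R * phi) - Psi rho x.
Proof.
elim: n => [|n IH]; first by rewrite bsum0 mul0r addr0 subrr.
have -> : x + n.+1%:R * phi = x + n%:R * phi + phi.
  by rewrite -natr1 mulrDl mul1r addrA.
by rewrite bsumS IH /adv addrC addrA subrK.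
Qed.

Lemma cvg_avg_adv rho phi x : 0 < rho ->
  avg (adv rho phi) phi x n @[n --> \oo] --> phi.
Proof.
move=> r0; apply: (@cvg_avg _ _ _ _ _ pi) => n.
rewrite bsum_adv.
have := Psi_dist rho (x + n%:R * phi) r0; have := Psi_dist rho x r0.
by rewrite !ler_norml; lra.
Qed.

(** The hypothesis says that the scalar product of (cos x, rho sin x) and its image
    is nonnegative. *)
Lemma adv_le_pihalf rho phi x : 0 < rho -> 0 <= phi <= pi ->
  0 <= cos x * cos (x + phi) + rho ^+ 2 * (sin x * sin (x + phi)) ->
  adv rho phi x <= pi / 2.
Proof.
move=> r0 hphi; have /andP[a0 a1] := adv_itv rho phi x r0 hphi.
have [k k0 [c1 s1]] := Psi_polar rho x r0.
have [k' k'0 [c2 s2]] := Psi_polar rho (x + phi) r0.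
have -> : cos x * cos (x + phi) + rho ^+ 2 * (sin x * sin (x + phi)) =
    k * k' * cos (adv rho phi x).
  rewrite (_ : rho ^+ 2 * _ = rho * sin x * (rho * sin (x + phi))); last ring.
  by rewrite c1 c2 s1 s2 /adv cosB; ring.
have p0 := pi_gt0 R.
rewrite pmulr_rge0 ?mulr_gt0// => h; rewrite leNgt; apply/negP => lt.
move: h; rewrite leNgt -cos_pihalf ltr_cos ?lt// in_itv/= ?a0 ?a1//.
by apply/andP; split; lra.
Qed.

(** The eigenvalues are cos phi + i sin phi and its conjugate. *)
Lemma spectral_radius_Amat rho phi : 0 < rho -> spectral_radius (Amat rho phi) = 1.
Proof.
move=> r0; rewrite /spectral_radius -[RHS](@sup1 R); apply: (congr1 (@sup R)).
set A := map_mx C _.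
have a01 : Amat rho phi 0 1 = - (rho^-1 * sin phi) by rewrite mxE.
have a10 : Amat rho phi 1 0 = rho * sin phi by rewrite mxE.
have A00 : A 0 0 = C (cos phi) by rewrite !mxE.
have A01 : A 0 1 = - (C rho^-1 * C (sin phi)) by rewrite mxE a01 rmorphN rmorphM.
have A10 : A 1 0 = C rho * C (sin phi) by rewrite mxE a10 rmorphM.
have A11 : A 1 1 = C (cos phi) by rewrite !mxE.
have Cr : C rho != 0 by rewrite fmorph_eq0 gt_eqF.
have CV : C rho^-1 = (C rho)^-1 by rewrite fmorphV.
have i2 : ('i%C : R[i]) ^+ 2 = -1 by rewrite sqr_i.
have vA (v : 'rV[R[i]]_2) (j : 'I_2) : (v *m A) 0 j = v 0 0 * A 0 j + v 0 1 * A 1 j.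
  rewrite mxE !big_ord_recl big_ord0 addr0.
  by congr (_ + v _ _ * A _ _); exact/val_inj.
(* used with s = 1 and s = -1, for the two eigenvalues *)
have nrm (s : R) : s ^+ 2 = 1 ->
    ComplexField.Normc.normc (C (cos phi) + 'i%C * C (s * sin phi)) = 1.
  move=> s2; rewrite /= !(mul0r, mulr0, mul1r, subr0, addr0, add0r).
  by rewrite exprMn s2 mul1r cos2Dsin2 sqrtr1.
apply/seteqP; split => y /=.
- case=> z /eigenvalueP[v hv v0] <-.
  have h0 := congr1 (fun w : 'rV_2 => w 0 0) hv.
  have h1 := congr1 (fun w : 'rV_2 => w 0 1) hv.
  rewrite /= vA A00 A10 mxE in h0; rewrite /= vA A01 A11 mxE CV in h1.
  have : (z - C (cos phi)) ^+ 2 = ('i%C * C (sin phi)) ^+ 2.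
    move: h0 h1 Cr; rewrite exprMn i2 mulN1r.
    move: (C (cos phi)) (C (sin phi)) (C rho) => c s r h0 h1 r0'.
    apply/eqP; rewrite -subr_eq0 opprK; apply: contraNT v0 => E0.
    have e0 : (z - c) * v 0 0 = r * s * v 0 1.
      by rewrite mulrBl -h0; ring.
    have e1 : (z - c) * v 0 1 = - (r^-1 * s) * v 0 0.
      by rewrite mulrBl -h1; ring.
    have k0 : ((z - c) ^+ 2 + s ^+ 2) * v 0 0 = 0.
      rewrite mulrDl expr2 -mulrA e0 mulrCA e1.
      by field.
    have k1 : ((z - c) ^+ 2 + s ^+ 2) * v 0 1 = 0.
      rewrite mulrDl expr2 -mulrA e1 mulrCA e0.
      by field.
    apply/eqP/matrixP => i j; rewrite (ord1 i) [RHS]mxE.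
    have [->|->] : j = 0 \/ j = 1.
      by case: j => -[|[|//]] hj; [left|right]; exact/val_inj.
    - by move/eqP: k0; rewrite mulf_eq0 (negbTE E0) => /eqP.
    - by move/eqP: k1; rewrite mulf_eq0 (negbTE E0) => /eqP.
  move/eqP; rewrite eqf_sqr !subr_eq => /orP[]/eqP ->.
    by have := nrm 1 (expr1n _ _); rewrite mul1r addrC.
  by have := nrm (-1); rewrite sqrrN expr1n => /(_ erefl);
    rewrite mulN1r rmorphN mulrN addrC.
- move=> ->; exists (C (cos phi) + 'i%C * C (1 * sin phi)); last by rewrite nrm ?expr1n.
  (* [eigenvalue] refers to the action on row vectors. *)
  pose w : 'rV[R[i]]_2 := \row_j if j == 0 then C rho else 'i%C.
  have w0 : w 0 0 = C rho by rewrite mxE.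
  have w1 : w 0 1 = 'i%C by rewrite mxE.
  apply/eigenvalueP; exists w.
    apply/matrixP => i j; rewrite (ord1 i) vA [RHS]mxE mul1r.
    have [->|->] : j = 0 \/ j = 1.
      by case: j => -[|[|//]] hj; [left|right]; exact/val_inj.
    - by rewrite w0 w1 A00 A10; ring.
    rewrite w0 w1 A01 A11 mulrN mulrA CV mulfV// mul1r mulrDl mulrAC -expr2 i2.
    by ring.
  apply/eqP => w_eq0; move: w0; rewrite w_eq0 mxE => /esym/eqP.
  by rewrite (negbTE Cr).
Qed.

(** An antisymmetric matrix with nonnegative lower left entry m is m times the
    rotation by pi/2. *)
Lemma spectral_norm_skew (m : R) (M : 'M[R]_2) : 0 <= m ->
  (forall a b, M *m vec2 a b = vec2 (- (m * b)) (m * a)) -> spectral_norm M = m.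
Proof.
move=> m0 hM; rewrite /spectral_norm -[RHS](@sup1 R); apply: (congr1 (@sup R)).
have en a b : enorm (M *m vec2 a b) = m * enorm (vec2 a b).
  rewrite hM !enorm_vec2 sqrrN !exprMn addrC -mulrDr sqrtrM ?sqr_ge0//.
  by rewrite sqrtr_sqr ger0_norm.
apply/seteqP; split => y /=.
- by case=> v v1 <-; move: v1; rewrite [v]vec2E en => ->; rewrite mulr1.
- move=> ->; have e1 : enorm (vec2 1 0 : 'cV[R]_2) = 1.
    by rewrite enorm_vec2 expr1n expr0n addr0 sqrtr1.
  by exists (vec2 1 0) => //; rewrite en e1 mulr1.
Qed.

Lemma skewness_Amat rho phi : 0 < rho -> 0 <= sin phi ->
  skewness (Amat rho phi) = 2^-1 * ((rho + rho^-1) * sin phi).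
Proof.
move=> r0 s0; rewrite /skewness spectral_radius_Amat// mulr1; congr (_ * _).
apply: spectral_norm_skew; first by rewrite mulr_ge0// addr_ge0 ?invr_ge0 1?ltW.
move=> a b; rewrite mulmxBl.
have -> : (Amat rho phi)^T *m vec2 a b =
    vec2 (cos phi * a + rho * sin phi * b) (- (rho^-1 * sin phi) * a + cos phi * b).
  apply/matrixP => i j; rewrite !mxE !big_ord_recl big_ord0 !mxE /= addr0.
  by case: i => -[|[|//]] hi.
rewrite Amat_vec2; apply/matrixP => i j; rewrite !mxE.
by case: (i == 0); ring.
Qed.

End Rotation.

(** * The four cases and the reflection *)

Section Cases.
Context {R : realType}.
Implicit Types (rho phi x y : R).
Notation mu := (@lebesgue_measure R).

Lemma adv_Dpi rho phi x : adv rho phi (x + pi) = adv rho phi x.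
Proof. by rewrite /adv (addrAC x) !Psi_Dpi; ring. Qed.

Lemma adv_lip rho phi x y : 0 < rho -> rho <= 1 ->
  `|adv rho phi y - adv rho phi x| <= 2 * rho^-1 * `|y - x|.
Proof.
move=> r0 r1; rewrite /adv.
have := Psi_lipschitz rho (x + phi) (y + phi) r0 r1.
have := Psi_lipschitz rho x y r0 r1.
rewrite (_ : y + phi - (x + phi) = y - x); last ring.
move=> h1 h2.
rewrite (_ : _ - _ - _ = (Psi rho (y + phi) - Psi rho (x + phi)) -
  (Psi rho y - Psi rho x)); last ring.
by rewrite (le_trans (ler_normB _ _))// -mulrA mulr2n mulrDl mul1r lerD.
Qed.

Lemma angular_value_small_skew rho phi : 0 < rho -> rho <= 1 ->
  0 < phi <= pi / 2 -> skewness (Amat rho phi) <= 1 ->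
  first_angular_value (Amat rho phi) = phi.
Proof.
move=> r0 r1 /andP[p0 p1] sk; have pi0 := pi_gt0 R.
have hphi : 0 <= phi <= pi by lra.
have s0 : 0 <= sin phi by rewrite sin_ge0_pi.
have c0 : 0 <= cos phi by rewrite cos_ge0_pihalf// p1 andbT; lra.
(* The bound (1 + rho^2) sin phi <= 2 rho on the skewness, squared and
   subtracted from (1 + rho^2)^2. *)
have key : 1 - rho ^+ 2 <= (1 + rho ^+ 2) * cos phi.
  have r2 : rho ^+ 2 <= 1 by rewrite expr_le1// ltW.
  rewrite -ler_sqr ?nnegrE; [|lra|by rewrite mulr_ge0// addr_ge0 ?sqr_ge0].
  have : (1 + rho ^+ 2) * sin phi <= 2 * rho.
    move: sk; rewrite skewness_Amat// ler_pdivrMl// mulr1.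
    rewrite -(ler_pM2l r0) mulrA mulrDr mulfV ?gt_eqF// -expr2 addrC.
    by rewrite [leRHS]mulrC.
  move=> h; have : ((1 + rho ^+ 2) * sin phi) ^+ 2 <= (2 * rho) ^+ 2.
    by rewrite ler_sqr ?nnegrE// mulr_ge0 ?addr_ge0 ?sqr_ge0 ?(ltW r0).
  rewrite !exprMn sin2cos2.
  by move: (cos phi ^+ 2) => c; lra.
have turnE x : turn rho phi x = adv rho phi x.
  apply/turn_adv/adv_le_pihalf => //.
  have := cosB (x + phi) x; rewrite [x + phi]addrC addrK [phi + x]addrC => e1.
  have e2 := cosD (x + phi) x.
  have := cos_geN1 (x + phi + x); have r2 : rho ^+ 2 <= 1 by rewrite expr_le1// ltW.
  move: e1 e2; set c := cos x * _; set s := sin x * _.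
  rewrite (mulrC _ (cos x)) (mulrC _ (sin x)) -/c -/s => e1 -> hcs.
  move: key; rewrite e1 => key.
  have : 0 <= (1 - rho ^+ 2) * (c - s + 1) by rewrite mulr_ge0; lra.
  lra.
rewrite (first_angular_value_max _ _ (fun=> phi) 0)// => x.
rewrite (_ : turn rho phi = adv rho phi); last exact/funext.
exact: cvg_avg_adv.
Qed.

Lemma delta_Dpi rho phi x : delta rho phi (x + pi) = delta rho phi x.
Proof. by rewrite /delta (addrAC x) !Psi_Dpi; ring. Qed.

Lemma integral_delta_neg rho phi :
  \int[mu]_(t in [set t : R | 0 <= t <= pi /\ delta rho phi t < 0]) delta rho phi t =
  \int[mu]_(t in `[0, pi]) Num.min 0 (delta rho phi t).
Proof.
rewrite Rintegral_mkcond [RHS]Rintegral_mkcond; congr Rintegral.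
apply/funext => t; rewrite !patchE mem_setE in_itv /=.
case: ifPn => [/set_mem/= [-> d0]|].
  by rewrite min_r// ltW.
move=> /negP h; case: ifPn => // t01; rewrite min_l// leNgt; apply/negP => d0.
by apply: h; apply/mem_set.
Qed.

Lemma angular_value_irrational rho phi : 0 < rho -> rho <= 1 -> 0 < phi <= pi / 2 ->
  (~ exists r : rat, phi / pi = ratr r) ->
  first_angular_value (Amat rho phi) =
  phi + pi^-1 *
   (\int[mu]_(t in [set t : R | 0 <= t <= pi /\ delta rho phi t < 0]) delta rho phi t).
Proof.
move=> r0 r1 /andP[p0 p1] irr; have pi0 := pi_gt0 R.
have hphi : 0 <= phi <= pi by lra.
rewrite integral_delta_neg; set c := phi + _.
rewrite (first_angular_value_max _ _ (fun=> c) 0)// => x.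
pose f t := Num.min 0 (delta rho phi t).
have -> : avg (turn rho phi) phi x = (fun n => avg (adv rho phi) phi x n + avg f phi x n).
  apply/funext => n; rewrite /avg /bsum -mulrDr -big_split /=; congr (_ * _).
  by apply: eq_bigr => j _; rewrite turnE.
have dE t : delta rho phi t = pi - 2 * adv rho phi t by rewrite /delta /adv; ring.
apply: cvgD; first exact: cvg_avg_adv.
apply: (@cvg_avg_irrational _ f phi pi (2 * (2 * rho^-1))) => //; last exact: ltW.
- by move=> y; rewrite /f delta_Dpi.
- move=> y; rewrite /f dE; have := adv_itv rho phi y r0 hphi => h.
  by rewrite ler_norml; case: (leP 0 (pi - 2 * adv rho phi y)); lra.
move=> u v; rewrite -mulrA; apply: (@le_trans _ _ (2 * `|adv rho phi v - adv rho phi u|)).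
  rewrite /f !dE; case: (ger0P (adv rho phi v - adv rho phi u)) => ?.
    by rewrite ler_norml; case: (leP 0 (pi - 2 * adv rho phi v));
      case: (leP 0 (pi - 2 * adv rho phi u)); lra.
  by rewrite ler_norml; case: (leP 0 (pi - 2 * adv rho phi v));
    case: (leP 0 (pi - 2 * adv rho phi u)); lra.
by rewrite ler_wpM2l// adv_lip.
Qed.

Lemma turn_lip rho phi x y : 0 < rho -> rho <= 1 ->
  `|turn rho phi y - turn rho phi x| <= 2 * rho^-1 * `|y - x|.
Proof.
move=> r0 r1; apply: le_trans (adv_lip rho phi x y r0 r1).
rewrite /turn; set a := adv _ _ _; set b := adv _ _ _.
rewrite ler_norml; case: (ger0P (a - b)) => ?;
  by case: (leP a (pi - a)); case: (leP b (pi - b)); lra.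
Qed.

(** The fraction p/q need not be in lowest terms: only the phi-periodicity of the
    sum over q steps is used. *)
Lemma angular_value_rational rho phi (p q : nat) : 0 < rho -> rho <= 1 ->
  0 < phi <= pi / 2 -> (0 < q)%N -> q%:R * phi = p%:R * pi ->
  exists x0, [/\ 0 <= x0 <= pi / 2,
    forall x, bsum (turn rho phi) phi x q <= bsum (turn rho phi) phi x0 q &
    first_angular_value (Amat rho phi) = q%:R^-1 * bsum (turn rho phi) phi x0 q].
Proof.
move=> r0 r1 /andP[p0 p1] q0 pq; have pi0 := pi_gt0 R.
have hphi : 0 <= phi <= pi by lra.
pose S x := bsum (turn rho phi) phi x q.
have turnq y : turn rho phi (y + q%:R * phi) = turn rho phi y.
  rewrite pq -[p%:R]/((p%:Z)%:~R) periodic_int// => z.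
  by rewrite /turn adv_Dpi.
have Sphi x : S (x + phi) = S x.
  have := bsumD (turn rho phi) phi x 1 q; rewrite addnC bsumD mul1r.
  rewrite (_ : bsum _ _ (x + q%:R * phi) 1 = bsum (turn rho phi) phi x 1).
    by rewrite -/(S x) -/(S (x + phi)); lra.
  by rewrite !bsumS !bsum0 mul0r !addr0 turnq.
have Sc : continuous S.
  apply: (@lipschitz_continuous _ _ (q%:R * (2 * rho^-1))) => u v.
  rewrite -mulrA; apply: bsum_lip => a b; exact: turn_lip.
have pi2 : (0 : R) <= pi / 2 by lra.
have [x0 x0I hx0] := EVT_max pi2 (continuous_subspaceT Sc).
have Smax x : S x <= S x0.
  (* x - m phi lies in [0, phi[, hence in [0, pi/2]. *)
  pose m := Num.floor (x / phi).
  have := floor_itv (x / phi); rewrite -/m intrD ler_pdivlMr// ltr_pdivrMr// mulrDl mul1r.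
  move=> /andP[m0 m1].
  rewrite -(periodic_int S phi x (- m) Sphi); apply: hx0.
  by rewrite in_itv/= intrN mulNr; lra.
exists x0; split => //.
rewrite (first_angular_value_max _ _ (fun x => q%:R^-1 * S x) x0)//.
  by move=> x; exact: cvg_avg_periodic.
by move=> x; rewrite ler_wpM2l ?invr_ge0.
Qed.

Lemma bsum_turn_le_adv rho phi x (n : nat) :
  bsum (turn rho phi) phi x n <= bsum (adv rho phi) phi x n.
Proof. by apply: ler_sum => j _; exact: turn_le_adv. Qed.

Lemma angular_value_pi_div rho phi (q : nat) : 0 < rho -> rho <= 1 -> (2 <= q)%N ->
  phi / pi = 1 / q%:R -> 0 < phi <= pi / 2 ->
  first_angular_value (Amat rho phi) = phi.
Proof.
move=> r0 r1 q2 hq hphi; have pi0 := pi_gt0 R.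
have q0 : (0 < q)%N by exact: leq_trans q2.
have q0' : q%:R != 0 :> R by rewrite pnatr_eq0 -lt0n.
have qphi : q%:R * phi = pi.
  move/eqP: hq; rewrite eqr_div ?(gt_eqF pi0)// mul1r => /eqP.
  by rewrite mulrC.
have [|x0 [_ hmax ->]] := angular_value_rational rho phi 1 q r0 r1 hphi q0.
  by rewrite mul1r.
suff -> : bsum (turn rho phi) phi x0 q = pi by rewrite -qphi mulKf.
have sadv x : bsum (adv rho phi) phi x q = pi.
  by rewrite bsum_adv qphi Psi_Dpi addrAC subrr add0r.
apply/eqP; rewrite eq_le -{1}(sadv x0) bsum_turn_le_adv/=.
(* The orbit of -pi/2 is -pi/2, -pi/2 + phi, ..., pi/2, and at both ends of
   each of its steps the cosine is nonnegative. *)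
apply: le_trans (hmax (- (pi / 2))); rewrite -{1}(sadv (- (pi / 2))).
have /andP[p0 p1] := hphi.
rewrite /bsum !big_mkord; apply: ler_sum => j _.
set a := _ + _; rewrite turn_adv//; apply: adv_le_pihalf => //; first lra.
have jq : (j%:R + 1) * phi <= pi.
  by rewrite natr1 -qphi ler_wpM2r ?(ltW p0)// ler_nat.
have j0 : 0 <= j%:R * phi by rewrite mulr_ge0 ?(ltW p0).
have ca : 0 <= cos a by apply: cos_ge0_pihalf; rewrite /a; lra.
have ca' : 0 <= cos (a + phi) by apply: cos_ge0_pihalf; rewrite /a; lra.
have : 0 <= cos phi by apply: cos_ge0_pihalf; lra.
have cc : 0 <= cos a * cos (a + phi) by rewrite mulr_ge0.
have := cosB (a + phi) a; rewrite [a + phi]addrC addrK [phi + a]addrC => ->.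
rewrite (mulrC _ (cos a)) (mulrC _ (sin a)).
move: (cos a * _) (sin a * _) cc => c s cc cs.
have r2 : rho ^+ 2 <= 1 by rewrite expr_le1// ltW.
have r20 := sqr_ge0 rho.
case: (leP 0 s) => hs; first by rewrite addr_ge0// mulr_ge0.
by nra.
Qed.

Lemma sum_gE rho phi t (q : nat) :
  \sum_(1 <= j < q.+1) g rho phi j t = bsum (turn rho phi) phi (Psi rho^-1 t) q.
Proof.
rewrite big_add1 /=; apply: eq_bigr => j _.
rewrite /g /turn /theta_seq /adv /= -natr1 mulrDl mul1r.
rewrite (addrC _ (Psi rho^-1 t)) addrA (addrC (j%:R * phi)).
by congr Num.min; ring.
Qed.

Lemma angular_value_sum_g rho phi (p q : nat) : 0 < rho -> rho <= 1 ->
  0 < phi <= pi / 2 -> (0 < q)%N -> phi / pi = p%:R / q%:R ->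
  exists m : R,
    is_maximum [set \sum_(1 <= j < q.+1) g rho phi j t
               | t in [set t : R | 0 <= t <= pi / 2]] m /\
    first_angular_value (Amat rho phi) = q%:R^-1 * m.
Proof.
move=> r0 r1 hphi q0 hpq; have pi0 := pi_gt0 R.
have q0' : q%:R != 0 :> R by rewrite pnatr_eq0 -lt0n.
have [|x0 [x0I hmax hfav]] := angular_value_rational rho phi p q r0 r1 hphi q0.
  by move/eqP: hpq; rewrite eqr_div ?(gt_eqF pi0)// => /eqP; rewrite mulrC.
exists (bsum (turn rho phi) phi x0 q); split => //; split.
  exists (Psi rho x0); last by rewrite sum_gE Psi_invK.
  have /andP[x00 x01] := x0I.
  by rewrite /= -{1}(Psi0E rho) -(Psi_pi2 rho) !Psi_homo.
by move=> _ [t _ <-]; rewrite sum_gE.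
Qed.

(** The reflection diag(1, -1). *)
Definition flip (v : 'cV[R]_2) : 'cV[R]_2 := vec2 (v 0 0) (- v 1 0).

Lemma flipK v : flip (flip v) = v.
Proof. by rewrite [RHS]vec2E /flip !mxE /= opprK. Qed.

Lemma Amat_flip rho phi v :
  Amat rho (pi - phi) *m flip v = - flip (Amat rho phi *m v).
Proof.
rewrite {2}[v]vec2E !Amat_vec2 sinB cosB sinpi cospi; apply/matrixP => i j.
by rewrite !mxE /=; case: (i == 0); ring.
Qed.

Lemma Amat_iter_flip rho phi v (n : nat) :
  Amat rho (pi - phi) ^+ n *m flip v = (-1) ^+ n *: flip (Amat rho phi ^+ n *m v).
Proof.
elim: n => [|n IH]; first by rewrite !expr0 !mul1mx scale1r.
rewrite !exprS -[_ * _ ^+ n in LHS]/(_ *m _) -[_ * Amat _ _ ^+ n]/(_ *m _).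
rewrite -!mulmxA IH -scalemxAr Amat_flip.
by rewrite scalerN mulN1r scaleNr.
Qed.

Lemma angle_flip v w (m n : nat) :
  angle ((-1) ^+ m *: flip v) ((-1) ^+ n *: flip w) = angle v w.
Proof.
have fE u (k : nat) : (-1) ^+ k *: flip u =
    vec2 ((-1) ^+ k * u 0 0) ((-1) ^+ k * - u 1 0).
  by apply/matrixP => i j; rewrite !mxE; case: (i == 0).
have en u (k : nat) : enorm ((-1) ^+ k *: flip u) = enorm u.
  rewrite fE [in RHS](vec2E u) !enorm_vec2 !exprMn sqrr_sign !mul1r.
  by rewrite sqrrN.
rewrite /angle !en; congr (acos (_ / _)).
have vw : (v^T *m w) 0 0 = v 0 0 * w 0 0 + v 1 0 * w 1 0.
  by rewrite {1}[v]vec2E {1}[w]vec2E dot_vec2.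
rewrite !fE dot_vec2 vw.
rewrite (_ : _ + _ = (-1) ^+ m * (-1) ^+ n * (v 0 0 * w 0 0 + v 1 0 * w 1 0)).
  by rewrite !normrM !normr_sign !mul1r.
by move: ((-1) ^+ m) ((-1) ^+ n) => e e'; ring.
Qed.

Lemma first_angular_value_pi_sub rho phi :
  first_angular_value (Amat rho (pi - phi)) = first_angular_value (Amat rho phi).
Proof.
rewrite /first_angular_value; apply: (congr1 (@sup R)).
have limE v : limn_sup (fun n : nat => n%:R^-1 * \sum_(1 <= j < n.+1)
      angle (Amat rho (pi - phi) ^+ j.-1 *m flip v)
            (Amat rho (pi - phi) ^+ j *m flip v)) =
    limn_sup (fun n : nat => n%:R^-1 * \sum_(1 <= j < n.+1)
      angle (Amat rho phi ^+ j.-1 *m v) (Amat rho phi ^+ j *m v)).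
  congr limn_sup; apply/funext => n; congr (_ * _); apply: eq_bigr => j _.
  by rewrite !Amat_iter_flip angle_flip.
have flip_neq0 v : v != 0 -> flip v != 0.
  apply: contra => /eqP h; rewrite -[v]flipK h; apply/eqP/matrixP => i j.
  by rewrite !mxE oppr0 if_same.
apply/seteqP; split => y [v v0 <-]; exists (flip v).
- exact: flip_neq0.
- by rewrite -limE flipK.
- exact: flip_neq0.
- exact: limE.
Qed.

End Cases.

Theorem theorem6p1 (R : realType) (rho phi : R)
    (hrho0 : 0 < rho) (hrho1 : rho <= 1) :
  (0 < phi <= pi / 2 ->
    [/\ (skewness (Amat rho phi) <= 1 ->
           first_angular_value (Amat rho phi) = phi),
        (1 < skewness (Amat rho phi) ->
         (~ exists r : rat, phi / pi = ratr r) ->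
           first_angular_value (Amat rho phi) =
           phi + pi^-1 *
             (\int[lebesgue_measure]_(t in
                [set t : R | 0 <= t <= pi /\ delta rho phi t < 0])
                delta rho phi t)),
        (forall q : nat, (2 <= q)%N ->
         1 < skewness (Amat rho phi) ->
         phi / pi = 1 / q%:R ->
           first_angular_value (Amat rho phi) = phi)
      & (forall p q : nat, (0 < p)%N -> (0 < q)%N ->
         1 < skewness (Amat rho phi) ->
         phi / pi = p%:R / q%:R -> ~~ (p %| q)%N ->
           exists m : R,
             is_maximum [set \sum_(1 <= j < q.+1) g rho phi j t
                        | t in [set t : R | 0 <= t <= pi / 2]] m /\
             first_angular_value (Amat rho phi) = q%:R^-1 * m)]) /\
  (pi / 2 < phi < pi ->
    first_angular_value (Amat rho phi) =
    first_angular_value (Amat rho (pi - phi))).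
Proof.
split=> [hphi|_]; last by rewrite first_angular_value_pi_sub.
split.
- exact: angular_value_small_skew.
- by move=> _; exact: angular_value_irrational.
- by move=> q q2 _ hq; exact: angular_value_pi_div q2 hq hphi.
- by move=> p q _ q0 _ hpq _; exact: angular_value_sum_g hpq.
Qed.
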